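(* Let $\varepsilon>0$, let $v,b\ge 1$ be integers, and let $Q$ be the $b\times v$ transition probability matrix of an $\varepsilon$-locally differentially private local randomiser with input domain $\{1,\dots,v\}$ and output range $\{1,\dots,b\}$, having no two equal rows. Suppose that: (1) the entries of $Q$ take exactly two distinct values, a ''large'' value $L$ and a ''small'' value $S$ with $L>S$; (2) the ratio between any two entries of $Q$ lies in $\{e^{-\varepsilon},1,e^{\varepsilon}\}$ (so $L=e^{\varepsilon}S$); (3) there is an integer $k$, equal to either $\lfloor v/(e^{\varepsilon}+1)\rfloor$ or $\lceil v/(e^{\varepsilon}+1)\rceil$, such that every row of $Q$ contains exactly $k$ large entries; (4) the Gram matrix $Q^{T}Q$ has exactly two distinct eigenvalues, one of multiplicity $1$ and one of multiplicity $v-1$. Then $$Q = p\big((e^{\varepsilon}-1)A + J'\big),$$ where $J'$ is the $b\times v$ all-ones matrix, $A$ is the $b\times v$ incidence matrix of a $(b,v,r,k,\lambda)$-configuration (balanced incomplete block design) for some integers $r$ and $\lambda$, and $p = 1/(r(e^{\varepsilon}-1)+b)$. Furthermore, if in addition $b\le v$, then $A$ is the incidence matrix of a symmetrical balanced incomplete block design, i.e. $b=v$ and $r=k$.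
   Context: Local randomiser: a randomised map from $\{1,\dots,v\}$ to $\{1,\dots,b\}$, identified with its $b\times v$ transition probability matrix $Q_{ij}=\Pr[Y=i\mid X=j]$; thus the entries are nonnegative and every column of $Q$ sums to $1$. It is $\varepsilon$-locally differentially private if $Q_{yi}\le e^{\varepsilon}Q_{yj}$ for all $y\in\{1,\dots,b\}$ and all $i,j\in\{1,\dots,v\}$. Balanced incomplete block design (BIBD), also called a $(b,v,r,k,\lambda)$-configuration: a collection of $b$ distinct subsets (blocks) $B_1,\dots,B_b$ of $\{1,\dots,v\}$ such that each block has exactly $k$ elements, each element of $\{1,\dots,v\}$ lies in exactly $r$ blocks, and each $2$-element subset of $\{1,\dots,v\}$ is contained in exactly $\lambda$ blocks. Trivial designs are allowed (for instance $\lambda=0$ is permitted, and no upper bound such as $k<v-1$ is imposed). Its incidence matrix is the $b\times v$ zero-one matrix $A$ with $A_{ij}=1$ if and only if $j\in B_i$. Equivalently, a zero-one $b\times v$ matrix $A$ with pairwise distinct rows is the incidence matrix of a $(b,v,r,k,\lambda)$-configuration if and only if $AJ=kJ'$ and $A^{T}A=(r-\lambda)I+\lambda J$, where $J$ and $I$ are the all-ones and identity matrices of order $v$ and $J'$ is the $b\times v$ all-ones matrix. A BIBD is symmetrical (a $(v,k,\lambda)$-configuration) if $b=v$ and $r=k$. *)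

(* Defs.v *)
From mathcomp Require Import all_boot all_order all_algebra.
From mathcomp Require Import reals sequences exp.

Set Implicit Arguments.
Unset Strict Implicit.
Unset Printing Implicit Defensive.

Import Order.TTheory GRing.Theory Num.Theory.

Local Open Scope ring_scope.

(* The convention is Q i j = Pr[Y = i | X = j]: columns are indexed by the
   inputs, so it is the columns (not the rows) that sum to 1. *)
Definition transition_matrix (R : realType) (b v : nat) (Q : 'M[R]_(b, v)) :=
  (forall i j, 0 <= Q i j) /\ (forall j, \sum_(i < b) Q i j = 1).

Definition locally_private (R : realType) (eps : R) (b v : nat)
    (Q : 'M[R]_(b, v)) :=
  forall (y : 'I_b) (i j : 'I_v), Q y i <= expR eps * Q y j.

(* Blocks are enumerated by 'I_b, so that the rows of the incidence matrix are
   ordered. Injectivity says that the b blocks are distinct. Trivial designs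
   are included. *)
Definition bibd (b v : nat) (B : 'I_b -> {set 'I_v}) (r k lambda : nat) :=
  [/\ injective B,
      forall i : 'I_b, #|B i| = k,
      forall j : 'I_v, #|[set i | j \in B i]| = r
    & forall P : {set 'I_v}, #|P| = 2%N -> #|[set i | P \subset B i]| = lambda].

Definition symmetric_bibd (b v : nat) (B : 'I_b -> {set 'I_v})
    (r k lambda : nat) :=
  [/\ bibd B r k lambda, b = v & r = k].

Definition incidence_mx (R : realType) (b v : nat) (B : 'I_b -> {set 'I_v})
    : 'M[R]_(b, v) :=
  \matrix_(i, j) (j \in B i)%:R.
Arguments incidence_mx R {b v} B.

(* Main.v *)
Require Import Defs.
From mathcomp Require Import all_boot all_order all_algebra.
From mathcomp Require Import reals sequences exp.
From mathcomp Require Import ring.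

(* Let c be the common row sum of Q. The Gram matrix G of Q has positive entries
   and row sums c, so c is an eigenvalue of G. Cayley-Hamilton and the symmetry
   of G give (G - c)(G - l) = 0, with l the other eigenvalue. By the maximum
   principle the eigenvectors of G for c are constant, hence G - l is a constant
   matrix; for Q = S J' + (L - S) A this says that A is the incidence matrix of a
   design. If l = 0, the columns of Q coincide, which is impossible; otherwise G
   is invertible, so v <= b. *)

Import Order.TTheory GRing.Theory Num.Theory.

Local Open Scope ring_scope.

(** * Symmetric and entrywise positive real matrices *)

Section RealMatrices.
Variable R : realFieldType.

(** [G i i + G j j - 2 G i j] is the squared Euclidean distance between columns [i] and [j] of
    [A]. *)
Lemma gram_diff_eq0 m n (A : 'M[R]_(m, n)) (i j : 'I_n) :
  let G := A^T *m A in G i i + G j j = G i j *+ 2 -> forall y, A y i = A y j.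
Proof.
move=> G hG y; apply/eqP; rewrite -subr_eq0 -sqrf_eq0; apply/eqP.
apply: (@psumr_eq0P _ _ xpredT _ (fun z _ => sqr_ge0 (A z i - A z j))) => //.
rewrite -[RHS](subrr (G i i + G j j)) {2}hG !mxE -sumrMnl -big_split -sumrB.
by apply: eq_bigr => z _; rewrite !mxE /=; ring.
Qed.

(** By symmetry the [i]-th diagonal entry of [N *m N] is the sum of the squares of row [i]. *)
Lemma sqr_symmetric_mx_eq0 n (N : 'M[R]_n) : N^T = N -> N *m N = 0 -> N = 0.
Proof.
move=> symN N2; apply/matrixP=> i j; rewrite mxE.
apply/eqP; rewrite -sqrf_eq0; apply/eqP.
apply: (@psumr_eq0P _ _ xpredT _ (fun k _ => sqr_ge0 (N i k))) => //.
transitivity ((N *m N) i i); last by rewrite N2 mxE.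
rewrite mxE; apply: eq_bigr => k _.
by rewrite -[in N k i]symN mxE expr2.
Qed.

Lemma trmx_sub_scalar n (G : 'M[R]_n) x : (G - x%:M)^T = G^T - x%:M.
Proof. by rewrite linearB /= tr_scalar_mx. Qed.

Lemma trmx_exp n (N : 'M[R]_n.+1) m : (N ^+ m)^T = N^T ^+ m.
Proof.
elim: m => [|m IHm]; first by rewrite !expr0 trmx1.
by rewrite exprS exprSr -mulmxE trmx_mul IHm.
Qed.

Lemma nilpotent_symmetric_mx_eq0 n (N : 'M[R]_n.+1) m :
  N^T = N -> N ^+ m.+1 = 0 -> N = 0.
Proof.
move=> symN; elim: m => [|m IHm]; first by rewrite expr1.
move=> Nm; apply/IHm/sqr_symmetric_mx_eq0; first by rewrite trmx_exp symN.
by rewrite mulmxE -exprD addSnnS addnC exprD Nm mul0r.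
Qed.

(* Maximum principle: compare the two sides of [G x = c x] at a largest entry
   of [x]. *)
Lemma positive_mx_eigenvector_const n (G : 'M[R]_n.+1) (c : R) (x : 'cV_n.+1) :
    (forall i j, 0 < G i j) -> (forall i, \sum_j G i j = c) ->
  G *m x = c *: x -> forall i j, x i 0 = x j 0.
Proof.
move=> Gpos Gsum Gx.
pose i0 := [arg max_(i > ord0) x i 0]%O.
have xmax j : x j 0 <= x i0 0 by rewrite /i0; case: arg_maxP => // i _; apply.
suff xE j : x j 0 = x i0 0 by move=> i j; rewrite !xE.
have tge0 k : true -> 0 <= G i0 k * (x i0 0 - x k 0).
  by move=> _; rewrite mulr_ge0 ?subr_ge0 // ltW.
suff /(psumr_eq0P tge0)/(_ j isT)/eqP :
    \sum_k G i0 k * (x i0 0 - x k 0) = 0.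
  by rewrite mulf_eq0 gt_eqF //= subr_eq0 => /eqP.
have := congr1 (fun M : 'cV_n.+1 => M i0 0) Gx; rewrite !mxE => Gxi.
rewrite (eq_bigr (fun k => G i0 k * x i0 0 - G i0 k * x k 0)) => [|k _].
  by rewrite sumrB -mulr_suml Gsum Gxi subrr.
by rewrite mulrBr.
Qed.

(** The powers of the two linear factors are coprime and divide [char_poly G]; their product already
    has its degree. The exponent [n.+1] is crude, but enough to get nilpotency. *)
Lemma char_poly_two_roots_dvdp n (G : 'M[R]_n.+1) (l1 l2 : R) :
    l1 != l2 -> mup l1 (char_poly G) = 1%N -> mup l2 (char_poly G) = n ->
  char_poly G %| (('X - l1%:P) * ('X - l2%:P)) ^+ n.+1.
Proof.
move=> l12 m1 m2.
have p0 : char_poly G != 0 by rewrite -size_poly_gt0 size_char_poly.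
have d : ('X - l1%:P) ^+ 1 * ('X - l2%:P) ^+ n %| char_poly G.
  rewrite Gauss_dvdp; first by rewrite -!mup_geq // m1 m2 !leqnn.
  by rewrite coprimep_expl ?coprimep_expr ?coprimep_XsubC2 // subr_eq0 eq_sym.
have e : ('X - l1%:P) ^+ 1 * ('X - l2%:P) ^+ n %= char_poly G.
  rewrite -dvdp_size_eqp // size_char_poly size_Mmonic ?monic_exp //
    ?monicXsubC //.
    by rewrite !size_exp_XsubC.
  by rewrite expr1 polyXsubC_eq0.
rewrite -(eqp_dvdl _ e) exprMn; by apply: dvdp_mul; apply: dvdp_exp2l.
Qed.

(** No diagonalisation is used: Cayley-Hamilton makes the product nilpotent, and it is symmetric
    because its factors commute. *)
Lemma two_eigenvalues_quadratic n (G : 'M[R]_n.+1) (l1 l2 : R) :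
    G^T = G -> l1 != l2 ->
    mup l1 (char_poly G) = 1%N -> mup l2 (char_poly G) = n ->
  (G - l1%:M) *m (G - l2%:M) = 0.
Proof.
move=> symG l12 m1 m2.
have factorsE x y : (G - x%:M) *m (G - y%:M) =
                   horner_mx G (('X - x%:P) * ('X - y%:P)).
  by rewrite rmorphM !rmorphB /= horner_mx_X !horner_mx_C.
apply: (@nilpotent_symmetric_mx_eq0 _ _ n).
  rewrite trmx_mul !trmx_sub_scalar symG.
  by rewrite factorsE mulrC -factorsE.
rewrite factorsE -rmorphXn.
have /dvdpP [q ->] := char_poly_two_roots_dvdp _ _ _ _ l12 m1 m2.
by rewrite rmorphM /= Cayley_Hamilton mulr0.
Qed.

(* Since [(G - c)(G - l) = 0], the columns of [G - l] are eigenvectors for the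
   Perron eigenvalue [c], hence constant. *)
Lemma positive_symmetric_mx_quadratic n (G : 'M[R]_n.+1) (c l : R) :
    G^T = G -> (forall i j, 0 < G i j) -> (forall i, \sum_j G i j = c) ->
    (G - c%:M) *m (G - l%:M) = 0 ->
  exists a, G = l%:M + const_mx a.
Proof.
move=> symG Gpos Gsum Gcl; pose M : 'M[R]_n.+1 := G - l%:M.
have symM : M^T = M by rewrite trmx_sub_scalar symG.
have Mcol i i' j : M i j = M i' j.
  have := @positive_mx_eigenvector_const n G c (col j M) Gpos Gsum _ i i'.
  rewrite !mxE; apply.
  apply/eqP; rewrite -subr_eq0 -mul_scalar_mx -mulmxBl colE mulmxA.
  by rewrite Gcl mul0mx.
have ME : M = const_mx (M 0 0).
  apply/matrixP=> i j; rewrite [RHS]mxE (Mcol i 0 j).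
  by rewrite -[in LHS]symM [LHS]mxE; apply: Mcol.
by exists (M 0 0); rewrite -ME addrC subrK.
Qed.

Lemma two_eigenvalues_positive_symmetric_mx n (G : 'M[R]_n.+1) (c l1 l2 : R) :
    G^T = G -> (forall i j, 0 < G i j) -> (forall i, \sum_j G i j = c) ->
    l1 != l2 -> (forall l, eigenvalue G l -> l = l1 \/ l = l2) ->
    mup l1 (char_poly G) = 1%N -> mup l2 (char_poly G) = n ->
  exists l a, G = l%:M + const_mx a.
Proof.
move=> symG Gpos Gsum l12 ev m1 m2.
have G12 := @two_eigenvalues_quadratic n G l1 l2 symG l12 m1 m2.
(* [eigenvalue] refers to row vectors; the all-ones row works because, by symmetry, the column sums
   are [c] too. *)
have evc : eigenvalue G c.
  apply/eigenvalueP; exists (const_mx 1).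
    apply/rowP=> j; rewrite !mxE mulr1 -(Gsum j); apply: eq_bigr => i _.
    by rewrite mxE mul1r -[in LHS](congr1 (fun N : 'M_n.+1 => N i j) symG) mxE.
  by apply/eqP=> /rowP/(_ 0)/eqP; rewrite !mxE oner_eq0.
case: (ev c evc) => cE; subst c.
- by exists l2; apply: positive_symmetric_mx_quadratic Gsum G12.
- exists l1; apply: positive_symmetric_mx_quadratic Gsum _ => //.
  (* Transposing swaps the two symmetric factors, which puts [l2], now equal to [c], first. *)
  apply: trmx_inj.
  by rewrite trmx_mul !trmx_sub_scalar symG G12 trmx0.
Qed.

(** If [x *m G = 0], summing the entries gives [c] times the sum of [x], so that sum is 0. The
    constant part of [G] then kills [x], leaving [l *: x = 0]. *)
Lemma row_free_scalar_add_const n (c l a : R) (G : 'M[R]_n) :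
    G = l%:M + const_mx a -> (forall i, \sum_j G i j = c) ->
    c != 0 -> l != 0 ->
  row_free G.
Proof.
move=> GE Gsum c0 l0; apply: inj_row_free => x xG.
have sx : \sum_i x 0 i = 0.
  apply: (mulIf c0); rewrite mul0r mulr_suml.
  transitivity (\sum_j (x *m G) 0 j).
    under [RHS]eq_bigr do rewrite mxE.
    by rewrite exchange_big; apply: eq_bigr => i _; rewrite -mulr_sumr Gsum.
  by rewrite xG big1 // => j _; rewrite mxE.
apply/rowP=> j; rewrite mxE; apply: (mulfI l0); rewrite mulr0.
have := congr1 (fun y : 'rV_n => y 0 j) xG.
rewrite GE mulmxDr mul_mx_scalar !mxE.
under eq_bigr do rewrite mxE.
by rewrite -mulr_suml sx mul0r addr0.
Qed.

End RealMatrices.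

(** * Designs, and matrices affine in an incidence matrix *)

Lemma bibd_symmetric (b v : nat) (B : 'I_b -> {set 'I_v}) (r k lambda : nat) :
  (0 < v)%N -> b = v -> bibd B r k lambda -> symmetric_bibd B r k lambda.
Proof.
move=> v0 bv hB; split=> //; case: hB => _ hk hr _.
(* Counting the incidences by blocks and by points gives [b * k = v * r]. *)
have : (\sum_(i < b) #|B i| = \sum_(j < v) #|[set i | j \in B i]|)%N.
  under eq_bigr do rewrite -sum1_card big_mkcond.
  rewrite exchange_big; apply: eq_bigr => j _.
  by rewrite -sum1_card [RHS]big_mkcond; apply: eq_bigr => i _; rewrite inE.
rewrite (eq_bigr (fun=> k)) // [RHS](eq_bigr (fun=> r)) // !sum_nat_const.
by rewrite !card_ord bv => /eqP; rewrite eqn_pmul2l // => /eqP.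
Qed.

Section AffineIncidence.
Variables (R : realFieldType) (b v : nat) (B : 'I_b -> {set 'I_v}) (s t : R).

Let Q : 'M[R]_(b, v) := const_mx s + t *: \matrix_(i, j) (j \in B i)%:R.

Lemma sum_indicator n (P : pred 'I_n) :
  \sum_i (P i)%:R = #|[set i | P i]|%:R :> R.
Proof.
rewrite -sum1_card natr_sum [RHS]big_mkcond; apply: eq_bigr => i _.
by rewrite inE; case: (P i).
Qed.

Lemma colsum_affine_incidence j :
  \sum_i Q i j = b%:R * s + t * #|[set i | j \in B i]|%:R.
Proof.
under eq_bigr do rewrite !mxE.
by rewrite big_split sumr_const card_ord -mulr_sumr sum_indicator mulr_natl.
Qed.

Lemma rowsum_affine_incidence i : \sum_j Q i j = v%:R * s + t * #|B i|%:R.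
Proof.
under eq_bigr do rewrite !mxE.
rewrite big_split sumr_const card_ord -mulr_sumr sum_indicator mulr_natl.
by rewrite (_ : [set j | _] = B i) //; apply/setP=> j; rewrite inE.
Qed.

Lemma gram_affine_incidence j k :
  (Q^T *m Q) j k = b%:R * s ^+ 2
    + s * t * (#|[set i | j \in B i]|%:R + #|[set i | k \in B i]|%:R)
    + t ^+ 2 * #|[set i | [set j; k] \subset B i]|%:R.
Proof.
rewrite mxE -!sum_indicator -big_split /= !mulr_sumr mulr_natl.
rewrite -[b in s ^+ 2 *+ b]card_ord -sumr_const -!big_split /=.
apply: eq_bigr => i _; rewrite !mxE subUset !sub1set -mulnb natrM; ring.
Qed.

(** As [t] is nonzero, the constant column sums determine the replication number, and the constant
    off-diagonal Gram entries then determine the pair count. *)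
Lemma affine_incidence_bibd c l a k :
    t != 0 -> (forall j, \sum_i Q i j = c) ->
    Q^T *m Q = l%:M + const_mx a -> injective (fun i => row i Q) ->
    (forall i, #|B i| = k) -> (0 < v)%N ->
  exists r lambda : nat, bibd B r k lambda /\ b%:R * s + t * r%:R = c.
Proof.
move=> t0 Qcol Qgram Qinj hk v0.
pose r := #|[set i | Ordinal v0 \in B i]|.
have rE j : #|[set i | j \in B i]| = r.
  apply/eqP; rewrite -(eqr_nat R); apply/eqP/(mulfI t0)/(addrI (b%:R * s)).
  by rewrite -!colsum_affine_incidence !Qcol.
have lambdaE j k' : j != k' ->
    t ^+ 2 * #|[set i | [set j; k'] \subset B i]|%:R =
    a - b%:R * s ^+ 2 - s * t * (r%:R + r%:R).
  move=> jk; have := gram_affine_incidence j k'.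
  rewrite Qgram !mxE (negPf jk) mulr0n add0r !rE => ->; ring.
have cardE (P P' : {set 'I_v}) : #|P| = 2%N -> #|P'| = 2%N ->
    #|[set i | P \subset B i]| = #|[set i | P' \subset B i]|.
  move=> /eqP/cards2P[j [k1 [jk ->]]] /eqP/cards2P[j' [k2 [jk' ->]]].
  apply/eqP; rewrite -(eqr_nat R); apply/eqP.
  by apply: (mulfI (expf_neq0 2 t0)); rewrite !lambdaE.
have Binj : injective B.
  by move=> i i' BE; apply: Qinj; apply/rowP=> j; rewrite !mxE BE.
(* With fewer than two points there are no pairs, so the condition on [lambda] is vacuous and 0
   serves. *)
have [P0 /eqP P0card|noP] := pickP (fun P : {set 'I_v} => #|P| == 2%N).
- exists r, #|[set i | P0 \subset B i]|; split; last first.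
    by rewrite -(Qcol (Ordinal v0)) colsum_affine_incidence.
  by split=> // P Pcard; apply: cardE.
- exists r, 0%N; split; last first.
    by rewrite -(Qcol (Ordinal v0)) colsum_affine_incidence.
  by split=> // P /eqP; rewrite noP.
Qed.

End AffineIncidence.

(** * The two-valued randomiser *)

Theorem theorem2 (R : realType) (eps : R) (v b : nat) (Q : 'M[R]_(b, v))
    (L S : R) (k : nat)
    (heps : 0 < eps) (hv : (1 <= v)%N) (hb : (1 <= b)%N)
    (hQ : transition_matrix Q) (hldp : locally_private eps Q)
    (hrows : injective (fun i : 'I_b => row i Q))
    (hLS : S < L)
    (hvalues : forall x : R, (exists i j, Q i j = x) <-> (x = L \/ x = S))
    (hratio : forall (i i' : 'I_b) (j j' : 'I_v),
       Q i j / Q i' j' \in [:: expR (- eps); 1; expR eps])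
    (hk : k%:Z = Num.floor (v%:R / (expR eps + 1)) \/
          k%:Z = Num.ceil (v%:R / (expR eps + 1)))
    (hlarge : forall i : 'I_b, #|[set j | Q i j == L]| = k)
    (hgram : exists l1 l2 : R,
       [/\ l1 <> l2,
           forall l : R, eigenvalue (Q^T *m Q) l <-> (l = l1 \/ l = l2),
           mup l1 (char_poly (Q^T *m Q)) = 1%N
         & mup l2 (char_poly (Q^T *m Q)) = (v - 1)%N]) :
  exists (B : 'I_b -> {set 'I_v}) (r lambda : nat),
    [/\ bibd B r k lambda,
        Q = (1 / (r%:R * (expR eps - 1) + b%:R)) *:
              ((expR eps - 1) *: incidence_mx R B + const_mx 1)
      & (b <= v)%N -> symmetric_bibd B r k lambda].
Proof.
have [Qge0 Qcol] := hQ.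
have [iL [jL QL]] : exists i j, Q i j = L by apply/hvalues; left.
have [iS [jS QS]] : exists i j, Q i j = S by apply/hvalues; right.
have e1 : 1 < expR eps by rewrite expR_gt1.
have S_gt0 : 0 < S.
  rewrite lt_def -{2}QS Qge0 andbT; apply/eqP=> S0.
  (* If [S] were 0, the ratio [S / L] would be 0, whereas the three allowed ratios are positive. *)
  have := hratio iS iL jS jL; rewrite QS S0 mul0r !inE.
  by rewrite !(eq_sym 0) !gt_eqF // expR_gt0.
have LE : L = expR eps * S.
  have L_gt0 := lt_trans S_gt0 hLS.
  have LS1 : 1 < L / S by rewrite ltr_pdivlMr ?mul1r.
  have := hratio iL iS jL jS; rewrite QL QS !inE (gt_eqF LS1) orFb.
  case/orP=> /eqP LSE; last by rewrite -LSE divfK // gt_eqF.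
  have : expR (- eps) < 1 by rewrite expR_lt1 oppr_lt0.
  by rewrite -LSE ltNge ltW.
pose B i := [set j | Q i j == L].
have QE : Q = const_mx S + (L - S) *: \matrix_(i, j) (j \in B i)%:R.
  apply/matrixP=> i j; rewrite !mxE inE.
  have /hvalues[->|->] : exists i' j', Q i' j' = Q i j by exists i, j.
    by rewrite eqxx mulr1 addrC subrK.
  by rewrite lt_eqF // mulr0 addr0.
have Q_gt0 i j : 0 < Q i j.
  have /hvalues[->|->] // : exists i' j', Q i' j' = Q i j by exists i, j.
  exact: lt_trans hLS.
have LS0 : L - S != 0 by rewrite subr_eq0 gt_eqF.
pose c := v%:R * S + (L - S) * k%:R.
have Qrow i : \sum_j Q i j = c by rewrite QE rowsum_affine_incidence hlarge.
have c_gt0 : 0 < c.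
  by rewrite ltr_wpDr ?mulr_gt0 ?ltr0n // mulr_ge0 ?ler0n // subr_ge0 ltW.
(* The columns of [Q] sum to 1, so the Gram matrix inherits the row sum [c] of [Q]. *)
have Gsum i : \sum_j (Q^T *m Q) i j = c.
  under eq_bigr do rewrite mxE.
  rewrite exchange_big -[RHS]mul1r -(Qcol i) mulr_suml.
  by apply: eq_bigr => y _; rewrite -mulr_sumr Qrow mxE.
have [l [a GE]] : exists l a, Q^T *m Q = l%:M + const_mx a.
  (* The context is cut down so that [v] can be replaced by a successor, the size the spectral
     lemmas require. *)
  clear - hv hb hgram Q_gt0 Gsum; case: hgram => l1 [l2 [/eqP l12 ev m1 m2]].
  case: v hv Q Q_gt0 c Gsum ev m1 m2 => // n _ Q Q_gt0 c Gsum ev m1 m2.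
  apply: two_eigenvalues_positive_symmetric_mx Gsum l12 _ m1 _.
  - by rewrite trmx_mul trmxK.
  - move=> i j; rewrite mxE (bigD1 (Ordinal hb)) //= ltr_pwDl //.
      by rewrite mxE mulr_gt0.
    by apply: sumr_ge0 => y _; rewrite mxE mulr_ge0 ?ltW.
  - by move=> l /ev.
  - by rewrite m2 subn1.
have [r [lambda [hB hr]]] : exists r lambda : nat,
    bibd B r k lambda /\ b%:R * S + (L - S) * r%:R = 1.
  by apply: affine_incidence_bibd; rewrite -?QE //; eassumption.
exists B, r, lambda; split=> //.
(* The constant [p] is the small value [S]: with [L = expR eps * S], the column sum reads
   [(r (expR eps - 1) + b) S = 1]. *)
- have SE : 1 / (r%:R * (expR eps - 1) + b%:R) = S.
    have dS : (r%:R * (expR eps - 1) + b%:R) * S = 1.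
      by rewrite -[RHS]hr LE; ring.
    have d0 : r%:R * (expR eps - 1) + b%:R != 0.
      by apply: contra_eq_neq dS => ->; rewrite mul0r eq_sym oner_neq0.
    by apply: (mulfI d0); rewrite dS mul1r mulfV.
  rewrite SE {1}QE LE; apply/matrixP=> i j; rewrite !mxE; ring.
- move=> bv; apply: bibd_symmetric => //; apply/eqP; rewrite eqn_leq bv /=.
  have l0 : l != 0.
    apply/eqP=> l0; move: GE; rewrite l0 raddf0 add0r => GE.
    have Qconst y i j : Q y i = Q y j.
      apply: (gram_diff_eq0 _ _ _ Q); rewrite /= GE !mxE; ring.
    (* With equal columns every row is constant, so row [iS] has no large entry while row [iL] has
       one; yet both have [k]. *)
    have := hlarge iL; rewrite -(hlarge iS) => /eqP.
    rewrite [X in _ == X]eq_card0; last first.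
      by move=> j; rewrite !inE (Qconst _ j jS) QS lt_eqF.
    by rewrite cards_eq0 => /eqP/setP/(_ jL); rewrite !inE QL eqxx.
  (* The Gram matrix has rank [v], but factors through dimension [b]. *)
  have /eqP <- : row_free (Q^T *m Q).
    by apply: row_free_scalar_add_const GE Gsum _ l0; rewrite gt_eqF.
  exact: mulmx_max_rank.
Qed.
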